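(* Let $q$ be a prime power, let $\alpha_1,\dots,\alpha_n\in\mathbb{F}_q$ be distinct, let $\delta\in\mathbb{F}_q$, and let $k,r$ be integers with $2\le r\le k-1$ and $k<n$. Let $C_2$ be the code generated by $G_2$. Then $C_2$ is MDS if and only if all of the following hold: (i) for every $k$-element subset $\{i_1,\dots,i_k\}\subseteq\{1,\dots,n\}$, $$\sum_{1\le j_1<\dots<j_r\le k}\alpha_{i_{j_1}}\cdots\alpha_{i_{j_r}}\ne0;$$ (ii) for every $(k-1)$-element subset $\{i_1,\dots,i_{k-1}\}\subseteq\{1,\dots,n\}$, $$\sum_{1\le j_1<\dots<j_{r-1}\le k-1}\alpha_{i_{j_1}}\cdots\alpha_{i_{j_{r-1}}}\ne0;$$ (iii) for every $(k-2)$-element subset $\{i_1,\dots,i_{k-2}\}\subseteq\{1,\dots,n\}$, $$\sum_{1\le j_1<\dots<j_{r-2}\le k-2}\alpha_{i_{j_1}}\cdots\alpha_{i_{j_{r-2}}}\ne0$$ (for $r=2$ the left-hand side is by convention $1$); (iv) for every $(k-1)$-element subset $\{i_1,\dots,i_{k-1}\}\subseteq\{1,\dots,n\}$, $$\delta\sum_{1\le j_1<\dots<j_{r-1}\le k-1}\alpha_{i_{j_1}}\cdots\alpha_{i_{j_{r-1}}}-\Big(\sum_{s=1}^{k-1}\alpha_{i_s}\Big)\Big(\sum_{1\le j_1<\dots<j_{r-1}\le k-1}\alpha_{i_{j_1}}\cdots\alpha_{i_{j_{r-1}}}\Big)+\sum_{1\le j_1<\dots<j_r\le k-1}\alpha_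{i_{j_1}}\cdots\alpha_{i_{j_r}}\ne0.$$
   Context: For distinct $\alpha_1,\dots,\alpha_n\in\mathbb{F}_q$ and $1\le r\le k-1$, $G_{r,k}$ is the $k\times n$ matrix whose rows are $(\alpha_1^e,\alpha_2^e,\dots,\alpha_n^e)$ for $e=0,1,\dots,k-r-1,k-r+1,\dots,k$ in this order (all exponents from $0$ to $k$ except $k-r$; convention $0^0=1$). For $\delta\in\mathbb{F}_q$, $G_2$ is the $k\times(n+2)$ matrix obtained by appending to $G_{r,k}$ the two columns $(0,\dots,0,0,1)^T$ and $(0,\dots,0,1,\delta)^T$, in this order, and $C_2$ is the linear code over $\mathbb{F}_q$ generated by $G_2$. An $[N,k]$ linear code is MDS if its minimum distance equals $N-k+1$. *)

(* Defs.v *)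
From mathcomp Require Import all_boot all_order all_algebra.
Set Implicit Arguments.
Unset Strict Implicit.
Unset Printing Implicit Defensive.
Import GRing.Theory.
Local Open Scope ring_scope.

Definition hamming_dist (F : finFieldType) (N : nat) (u v : 'rV[F]_N) : nat :=
  #|[set j | u 0 j != v 0 j]|.

Definition is_min_dist (F : finFieldType) (N : nat) (C : {vspace 'rV[F]_N})
    (d : nat) : Prop :=
  (exists u v : 'rV[F]_N,
      [/\ u \in C, v \in C, u != v & hamming_dist u v = d])
  /\ (forall u v : 'rV[F]_N,
      u \in C -> v \in C -> u != v -> (d <= hamming_dist u v)%N).

(* There is no truncation in the subtraction, since \dim C <= N. *)
Definition is_MDS (F : finFieldType) (N : nat) (C : {vspace 'rV[F]_N}) : Prop :=
  is_min_dist C (N - \dim C + 1)%N.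

Definition code_of (F : finFieldType) (k N : nat) (G : 'M[F]_(k, N)) :
    {vspace 'rV[F]_N} :=
  <<[seq row i G | i : 'I_k]>>%VS.

(* [bump h i] is [i] for [i < h] and [i.+1] otherwise, so that
   [bump (k - r) i], for [i < k], runs increasingly through the exponents
   0, ..., k with k - r left out. *)
Definition Grk (F : finFieldType) (n k r : nat) (alpha : 'I_n -> F) :
    'M[F]_(k, n) :=
  \matrix_(i < k, j < n) alpha j ^+ bump (k - r) i.

Definition last_col (F : finFieldType) (k : nat) : 'cV[F]_k :=
  \col_(i < k) (if i.+1 == k then 1 else 0).

Definition delta_col (F : finFieldType) (k : nat) (delta : F) : 'cV[F]_k :=
  \col_(i < k) (if i.+1 == k then delta else if i.+2 == k then 1 else 0).

Definition G2 (F : finFieldType) (n k r : nat) (alpha : 'I_n -> F)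
    (delta : F) : 'M[F]_(k, n + 2) :=
  row_mx (Grk k r alpha) (row_mx (last_col F k) (delta_col k delta)).

Definition C2 (F : finFieldType) (n k r : nat) (alpha : 'I_n -> F)
    (delta : F) : {vspace 'rV[F]_(n + 2)} :=
  code_of (G2 k r alpha delta).

(* Increasing index tuples j_1 < ... < j_m are encoded as m-element subsets
   of I; for m = 0 the value is 1. *)
Definition elem_sym (F : finFieldType) (n : nat) (alpha : 'I_n -> F) (m : nat)
    (I : {set 'I_n}) : F :=
  \sum_(J : {set 'I_n} | (J \subset I) && (#|J| == m)) \prod_(j in J) alpha j.

(* Main.v *)
(** A message is the coefficient vector of a polynomial [p] of degree at most [k]
with no term in degree [k - r]; its codeword lists the values of [p] at the
[alpha j], followed by [p`_k] and [p`_(k - 1) + delta * p`_k]. The code is MDS iff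
no nonzero [p] gives [k] zero coordinates. Such a [p] is divisible by
[Q = \prod_(i in I) ('X - alpha i)], where [I] has [k], [k - 1] or [k - 2] elements
according to how many of the last two coordinates vanish. The cofactor is a
constant, except when only the very last coordinate vanishes, in which case it is
linear; since the coefficients of [Q] are the signed elementary symmetric
functions, the missing term of [p] yields the four conditions. *)

Require Import Defs.
From mathcomp Require Import all_boot all_order all_algebra.
From mathcomp Require Import zify ring.
Set Implicit Arguments.
Unset Strict Implicit.
Import GRing.Theory.
Local Open Scope ring_scope.

(** * Codes generated by a matrix, their dimension and the MDS property *)

Lemma exists_subset_card (T : finType) (A : {set T}) (m : nat) :
  (m <= #|A|)%N -> exists2 B : {set T}, B \subset A & #|B| = m.
Proof.
move=> /card_geqP[s [us <- sA]]; exists [set x in s].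
  by apply/subsetP => x; rewrite inE => /sA.
by rewrite cardsE; apply/card_uniqP.
Qed.

Lemma mem_code_of (F : finFieldType) (k N : nat) (G : 'M[F]_(k, N))
    (u : 'rV[F]_N) :
  reflect (exists a : 'rV_k, u = a *m G) (u \in code_of G).
Proof.
apply: (iffP idP) => [|[a ->]]; last first.
  rewrite mulmx_sum_row; apply: memv_suml => i _; apply: memvZ.
  by apply: memv_span; apply: image_f.
suff /subvP sG : (code_of G <= limg (linfun (mulmxr G)))%VS.
  by move=> /sG/memv_imgP[a _ ->]; exists a; rewrite lfunE.
apply/span_subvP => _ /imageP[i _ ->].
by apply/memv_imgP; exists (delta_mx 0 i); rewrite ?memvf // lfunE /= -rowE.
Qed.

Lemma dim_code_of (F : finFieldType) (k N : nat) (G : 'M[F]_(k, N)) :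
  row_free G -> \dim (code_of G) = k.
Proof.
move=> freeG; set f := linfun (mulmxr G : 'rV_k -> 'rV_N).
have -> : code_of G = limg f.
  apply/vspaceP => u; apply/mem_code_of/memv_imgP => [[a ->]|[a _ ->]].
    by exists a; rewrite ?memvf // lfunE.
  by exists a; rewrite lfunE.
rewrite limg_dim_eq ?dimvf /dim /= ?mul1n //.
apply/eqP; rewrite -subv0; apply/subvP => a; rewrite memv_cap memv_ker lfunE /=.
by case/andP=> _; rewrite mulmx_free_eq0 // memv0.
Qed.

Definition zeros (F : finFieldType) (N : nat) (u : 'rV[F]_N) : {set 'I_N} :=
  [set j | u 0 j == 0].

(* The rank of any k - 1 columns is less than k; this is what yields a codeword
   attaining the Singleton bound. *)
Lemma MDS_code_ofP (F : finFieldType) (k N : nat) (G : 'M[F]_(k, N)) :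
  (0 < k)%N -> row_free G ->
  is_MDS (code_of G) <->
  forall a : 'rV_k, a != 0 -> (#|zeros (a *m G)| < k)%N.
Proof.
move=> k_gt0 freeG; rewrite /is_MDS dim_code_of //.
have kN : (k <= N)%N by rewrite -(eqP freeG) rank_leq_col.
have distE (u v : 'rV[F]_N) :
    hamming_dist u v = (N - #|zeros (u - v)|)%N.
  rewrite /hamming_dist cardsCs card_ord; congr (_ - #|pred_of_set _|)%N.
  by apply/setP => j; rewrite !inE negbK !mxE subr_eq0.
have zN (u : 'rV[F]_N) : (#|zeros u| <= N)%N.
  by have := max_card (mem (zeros u)); rewrite card_ord.
split=> [[_ min] a a0|fewzeros].
  (* The distance to the zero codeword is the weight: at least [N - k + 1] nonzero entries leave at
     most [k - 1] zeros. *)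
  have /min : a *m G \in code_of G by apply/mem_code_of; exists a.
  move=> /(_ 0); rewrite mem0v mulmx_free_eq0 // distE subr0.
  by move=> /(_ isT a0); have := zN (a *m G); lia.
have lower (u v : 'rV_N) : u \in code_of G -> v \in code_of G -> u != v ->
    (N - k + 1 <= hamming_dist u v)%N.
  move=> /mem_code_of[a ->] /mem_code_of[b ->] ab.
  have /fewzeros : a - b != 0 by rewrite subr_eq0; apply: contraNneq ab => ->.
  rewrite mulmxBl distE; set z := #|_|; lia.
split=> //.
have [J _ cardJ] : exists2 J : {set 'I_N}, J \subset setT & #|J| = k.-1.
  by apply: exists_subset_card; rewrite cardsT card_ord (leq_trans (leq_pred k)).
pose H := colsub (enum_val : 'I_#|J| -> 'I_N) G.
have /rowV0Pn[a /sub_kermxP aH a0] : kermx H != 0.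
  rewrite kermx_eq0 /row_free neq_ltn; apply/orP; left.
  by rewrite (leq_ltn_trans (rank_leq_col H)) // cardJ; lia.
have aG0 : a *m G != 0 by rewrite mulmx_free_eq0.
exists (a *m G), 0; split=> //; rewrite ?mem0v //.
  by apply/mem_code_of; exists a.
apply/eqP; rewrite eqn_leq lower ?mem0v ?andbT //; last first.
  by apply/mem_code_of; exists a.
have sub : J \subset zeros (a *m G).
  apply/subsetP => j jJ; rewrite inE -(enum_rankK_in jJ jJ).
  have /rowP/(_ (enum_rank_in jJ j)) := aH.
  rewrite !mxE => /eqP; congr (_ == 0); apply: eq_bigr => i _.
  by rewrite mxE.
by rewrite distE subr0; have := subset_leq_card sub; rewrite cardJ; lia.
Qed.

(** * Coefficients of a product of linear factors *)

Lemma coef_prod_XsubC_elem_sym (F : finFieldType) (n m : nat)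
    (alpha : 'I_n -> F) (I : {set 'I_n}) :
  (m <= #|I|)%N ->
  (\prod_(i in I) ('X - (alpha i)%:P))`_(#|I| - m)
    = (-1) ^+ m * elem_sym alpha m I.
Proof.
move=> mI; rewrite (big_mkcond (mem I)) /=.
(* Each factor becomes a sum of two terms over all of ['I_n], so that distributivity expands the
   product over the sets [J] of indices contributing their first term. Outside [I] that term is 0,
   which kills every [J] not contained in [I]. *)
under eq_bigr => i _.
  rewrite (_ : (if i \in I then _ else _) =
    (if i \in I then - (alpha i)%:P else 0) + (if i \in I then 'X else 1));
    last by case: ifP => _; rewrite ?add0r // addrC.
  over.
rewrite bigA_distr coef_sum /elem_sym mulr_sumr [RHS]big_mkcond /=.
apply: eq_bigr => J _.
have [sJI|/subsetPn[i iJ iNI]] := boolP (J \subset I); last first.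
  by rewrite (bigD1 i) //= iJ (negPf iNI) mul0r coef0.
transitivity ((\prod_(i in J) - (alpha i)%:P * 'X^(#|I| - #|J|))`_(#|I| - m)).
  congr (nth 0 (polyseq _) _); rewrite -cardsDS // -prodr_const.
  rewrite [in RHS]big_mkcond [X in _ * X]big_mkcond -big_split /=.
  apply: eq_bigr => i _; rewrite inE; case: (boolP (i \in J)) => [iJ|_] /=.
    by rewrite (subsetP sJI) ?mulr1.
  by rewrite mul1r.
rewrite prodrN -rmorph_prod -(rmorphN1 (@polyC F)) -rmorphXn -rmorphM.
rewrite coefCM coefXn.
have -> : (#|I| - m == #|I| - #|J|)%N = (#|J| == m).
  by have := subset_leq_card sJI; move: mI; set x := #|I|; set y := #|J|; lia.
by case: eqP => [->|_]; rewrite ?mulr1 ?mulr0.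
Qed.

(** * Messages as polynomials without a term of degree [h] *)

Lemma horner_skip (R : nzSemiRingType) (k h : nat) (p : {poly R}) (x : R) :
  (h <= k)%N -> (size p <= k.+1)%N -> p`_h = 0 ->
  \sum_(i < k) p`_(bump h i) * x ^+ bump h i = p.[x].
Proof.
move=> hk sz_p ph0; rewrite (horner_coef_wide x sz_p).
have h_lt : (h < k.+1)%N by [].
by rewrite (bigD1_ord (Ordinal h_lt)) //= ph0 mul0r add0r.
Qed.

Definition message (R : nzSemiRingType) (k h : nat) (p : {poly R}) : 'rV_k :=
  \row_i p`_(bump h i).

Lemma message_surj (R : nzSemiRingType) (k h : nat) (a : 'rV[R]_k) :
  (h <= k)%N ->
  exists p : {poly R}, [/\ (size p <= k.+1)%N, p`_h = 0 & message k h p = a].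
Proof.
move=> hk; exists (\sum_(i < k) a 0 i *: 'X^(bump h i)); split.
- apply: (leq_trans (size_sum _ _ _)); apply/bigmax_leqP => i _.
  apply: (leq_trans (size_scale_leq _ _)); rewrite size_polyXn ltnS.
  by rewrite /bump; case: leqP; have := ltn_ord i; lia.
- rewrite coef_sum big1 // => i _.
  by rewrite coefZ coefXn (negPf (neq_bump h i)) mulr0.
- apply/rowP => j; rewrite mxE coef_sum (bigD1 j) //= coefZ coefXn eqxx mulr1.
  rewrite big1 ?addr0 // => i ij; rewrite coefZ coefXn.
  by rewrite (can_eq (bumpK h)) eq_sym (inj_eq val_inj) (negPf ij) mulr0.
Qed.

Lemma message_eq0 (R : nzSemiRingType) (k h : nat) (p : {poly R}) :
  (h <= k)%N -> (size p <= k.+1)%N -> p`_h = 0 -> (message k h p == 0) = (p == 0).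
Proof.
move=> hk sz_p ph0; apply/eqP/eqP => [|->]; last first.
  by apply/rowP => i; rewrite !mxE coef0.
move=> /rowP m0; apply/polyP => i; rewrite coef0.
have [->//|ih] := eqVneq i h.
have unbumpi : bump h (unbump h i) = i by rewrite unbumpKcond (negPf ih).
have [ik|ki] := ltnP (unbump h i) k.
  by have := m0 (Ordinal ik); rewrite !mxE /= unbumpi.
(* Here [unbump h i] is at least [k], hence at least [h], so [i] is at least [k.+1], beyond the size
   of [p]. *)
rewrite nth_default // (leq_trans sz_p) // -unbumpi.
by rewrite /bump (leq_trans hk ki).
Qed.

(** The last row always has exponent [k]. Since [r] is at least 2, the missing exponent is at most
    [k - 2], so the row before it has exponent [k - 1]; the appended columns thus read off the two
    top coefficients. *)
Lemma message_G2 (F : finFieldType) (n k r : nat) (alpha : 'I_n -> F)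
    (delta : F) (p : {poly F}) :
  (2 <= r)%N -> (r <= k - 1)%N -> (size p <= k.+1)%N -> p`_(k - r) = 0 ->
  message k (k - r) p *m G2 k r alpha delta
  = row_mx (\row_j p.[alpha j])
      (row_mx (p`_k)%:M (p`_(k - 1) + delta * p`_k)%:M).
Proof.
move=> r_ge2 r_le sz_p ph0; rewrite /G2 mul_mx_row.
congr row_mx; last rewrite (mul_mx_row _ (last_col F k));
  last apply: (f_equal2 (@row_mx F 1 1 1)).
- apply/rowP => j; rewrite !mxE -(horner_skip (alpha j) _ sz_p ph0) ?leq_subr //.
  by apply: eq_bigr => i _; rewrite !mxE.
- apply/rowP => j; rewrite (ord1 j) !mxE eqxx mulr1n.
  case: k r_le {sz_p ph0} => [|k] r_le; first lia.
  rewrite big_ord_recr big1 => [|i _]; last first.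
    by rewrite !mxE /= eqSS ltn_eqF ?mulr0.
  rewrite /= add0r !mxE eqxx mulr1 /=.
  by congr (p`_ _); rewrite /bump; case: leqP; lia.
- apply/rowP => j; rewrite (ord1 j) !mxE eqxx mulr1n.
  case: k r_le {sz_p ph0} => [|[|k]] r_le; try lia.
  rewrite !big_ord_recr big1 => [|i _]; last first.
    have ik := ltn_ord i.
    by rewrite !mxE /= !eqSS (ltn_eqF ik) (ltn_eqF (leqW ik)) mulr0.
  rewrite /= add0r !mxE /= eqxx !eqSS ltn_eqF // mulr1 subn1 mulrC.
  by congr (p`_ _ + _ * p`_ _); rewrite /bump; case: leqP; lia.
Qed.

(** * Counting the zeros of a codeword by roots and top coefficients *)

Lemma card_zeros_row_mx (F : finFieldType) (m n : nat) (u : 'rV[F]_m)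
    (v : 'rV[F]_n) :
  #|zeros (row_mx u v)| = (#|zeros u| + #|zeros v|)%N.
Proof.
rewrite -!sum1_card big_mkcond big_split_ord /= [in RHS]big_mkcond.
rewrite [X in (_ = _ + X)%N]big_mkcond.
by congr (_ + _)%N; apply: eq_bigr => j _; rewrite !inE ?row_mxEl ?row_mxEr.
Qed.

Lemma card_zeros_scalar (F : finFieldType) (c : F) :
  #|zeros (c%:M : 'rV_1)| = (c == 0).
Proof.
by rewrite -sum1_card big_mkcond big_ord1 inE mxE eqxx mulr1n; case: eqP.
Qed.

Lemma size_le_pred_coef0 (R : nzSemiRingType) (m : nat) (p : {poly R}) :
  (size p <= m.+1)%N -> p`_m = 0 -> (size p <= m)%N.
Proof.
move=> sz_p pm0; apply/leq_sizeP => j; rewrite leq_eqVlt => /orP[/eqP<- //|mj].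
by rewrite nth_default // (leq_trans sz_p).
Qed.

Definition roots_in (F : finFieldType) (n : nat) (alpha : 'I_n -> F)
    (p : {poly F}) : {set 'I_n} := [set j | root p (alpha j)].

Lemma prod_XsubC_dvdp (F : finFieldType) (n : nat) (alpha : 'I_n -> F)
    (I : {set 'I_n}) (p : {poly F}) :
  injective alpha ->
  (\prod_(i in I) ('X - (alpha i)%:P) %| p) = (I \subset roots_in alpha p).
Proof.
move=> alpha_inj; apply/idP/subsetP => [dv i iI|sI].
  rewrite inE -dvdp_XsubCl (dvdp_trans _ dv) //.
  by rewrite (bigD1 i) //= dvdp_mulIl.
rewrite -big_enum -(big_map alpha xpredT (fun x => 'X - x%:P)).
apply: uniq_roots_dvdp.
  by apply/allP => _ /mapP[i iI ->]; have := sI i; rewrite inE -mem_enum; apply.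
by rewrite uniq_rootsE map_inj_uniq ?enum_uniq.
Qed.

Lemma card_roots_in (F : finFieldType) (n : nat) (alpha : 'I_n -> F)
    (p : {poly F}) :
  injective alpha -> p != 0 -> (#|roots_in alpha p| < size p)%N.
Proof.
move=> alpha_inj p0.
have dv : \prod_(i in roots_in alpha p) ('X - (alpha i)%:P) %| p.
  by rewrite prod_XsubC_dvdp.
by have := dvdp_leq p0 dv; rewrite -big_enum size_prod_XsubC -cardE.
Qed.

(** The criterion on zeros passes from messages to polynomials because [message] is onto and, among
    admissible polynomials, kills only 0. *)
Lemma MDS_C2P (F : finFieldType) (n k r : nat) (alpha : 'I_n -> F)
    (delta : F) :
  injective alpha -> (2 <= r)%N -> (r <= k - 1)%N -> (k < n)%N ->
  is_MDS (C2 k r alpha delta) <->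
  forall p : {poly F}, (size p <= k.+1)%N -> p`_(k - r) = 0 -> p != 0 ->
    (#|roots_in alpha p| + ((p`_k == 0)%R + (p`_(k - 1) + delta * p`_k == 0)%R)
      < k)%N.
Proof.
move=> alpha_inj r_ge2 r_le k_lt_n.
have zerosE (p : {poly F}) : (size p <= k.+1)%N -> p`_(k - r) = 0 ->
    #|zeros (message k (k - r) p *m G2 k r alpha delta)|
    = (#|roots_in alpha p|
       + ((p`_k == 0)%R + (p`_(k - 1) + delta * p`_k == 0)%R))%N.
  move=> sz_p ph0; rewrite message_G2 // card_zeros_row_mx.
  rewrite (card_zeros_row_mx (p`_k)%:M).
  rewrite !card_zeros_scalar.
  by congr (#|pred_of_set _| + _)%N; apply/setP => j; rewrite !inE mxE.
have freeG : row_free (G2 k r alpha delta).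
  apply: inj_row_free => a.
  have [p [sz_p ph0 <-]] := message_surj a (leq_subr r k).
  move=> aG0; apply/eqP; rewrite message_eq0 ?leq_subr //.
  have := zerosE p sz_p ph0; rewrite aG0.
  have [//|p0] := eqVneq p 0.
  (* A nonzero [p] has at most [k] roots, so its codeword has at most [k + 2] zeros, fewer than the
     length [n + 2]. *)
  have := leq_trans (card_roots_in alpha_inj p0) sz_p.
  have -> : zeros (0 : 'rV[F]_(n + 2)) = setT.
    by apply/setP => j; rewrite !inE mxE eqxx.
  rewrite cardsT card_ord; set z := #|_|.
  by do 2!case: eqP => _; lia.
rewrite /C2 MDS_code_ofP //; last by lia.
split=> [H p sz_p ph0 p0|H a].
  by rewrite -zerosE //; apply: H; rewrite message_eq0 ?leq_subr.
have [p [sz_p ph0 <-]] := message_surj a (leq_subr r k).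
by rewrite message_eq0 ?leq_subr // zerosE //; apply: H.
Qed.

(** * The monic product over a set of evaluation points, and its multiples *)

Section MonicProduct.

Variables (F : finFieldType) (n : nat) (alpha : 'I_n -> F) (I : {set 'I_n}).

Local Notation Q := (\prod_(i in I) ('X - (alpha i)%:P)).

Lemma size_prod_XsubC_in : size Q = #|I|.+1.
Proof. by rewrite -big_enum size_prod_XsubC -cardE. Qed.

Lemma coef_prod_XsubC_card : Q`_#|I| = 1.
Proof.
have /monicP := monic_prod_XsubC (index_enum 'I_n) (mem I) alpha.
by rewrite lead_coefE size_prod_XsubC_in.
Qed.

Lemma coef_prod_XsubC_pred :
  (0 < #|I|)%N -> Q`_(#|I| - 1) = - \sum_(i in I) alpha i.
Proof.
move=> I_gt0; rewrite -!big_enum /= -(big_map alpha xpredT (fun x => 'X - x%:P)).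
rewrite -(big_map alpha xpredT id) -coefPn_prod_XsubC size_map -cardE -?lt0n //.
by rewrite subn1.
Qed.

(** Used with [d = 1], where the cofactor is a constant, and with [d = 2], where it is linear. *)
Lemma dvd_prod_XsubC_in (p : {poly F}) (d : nat) :
  injective alpha -> p != 0 -> (size p <= #|I| + d)%N ->
  I \subset roots_in alpha p ->
  exists g : {poly F}, [/\ p = g * Q, g != 0 & (size g <= d)%N].
Proof.
move=> alpha_inj p0 sz_p; rewrite -prod_XsubC_dvdp // => /dvdpP[g pE].
have g0 : g != 0 by apply: contraNneq p0 => g0; rewrite pE g0 mul0r.
exists g; split=> //; move: sz_p.
rewrite pE size_Mmonic ?monic_prod_XsubC // size_prod_XsubC_in; lia.
Qed.

(* With [D] the left-hand side of condition (iv), the requirements that a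
   multiple of [Q] of degree at most [#|I| + 1] has a zero at the last coordinate
   and no term in degree [#|I| + 1 - r] amount to [D = 0] for nonzero [a]. *)
Lemma coef_linear_mul_prod (delta a b : F) (r : nat) :
  (0 < r <= #|I|)%N ->
  let p := (a%:P * 'X + b%:P) * Q in
  [/\ p`_#|I|.+1 = a, p`_#|I| = b - a * \sum_(i in I) alpha i
    & b = a * (\sum_(i in I) alpha i) - delta * a ->
      p`_(#|I|.+1 - r) = (-1) ^+ r * a *
        (delta * elem_sym alpha (r - 1) I
         - (\sum_(s in I) alpha s) * elem_sym alpha (r - 1) I
         + elem_sym alpha r I)].
Proof.
move=> /andP[r_gt0 rI] p.
have pE m : p`_m.+1 = a * Q`_m + b * Q`_m.+1.
  by rewrite /p mulrDl coefD -mulrA !coefCM coefXM.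
have QK1 : Q`_#|I|.+1 = 0 by rewrite nth_default // size_prod_XsubC_in.
have QK := coef_prod_XsubC_card.
have I_gt0 := leq_trans r_gt0 rI; have QK' := coef_prod_XsubC_pred I_gt0.
split=> [||bE].
- by rewrite pE QK QK1 mulr1 mulr0 addr0.
- rewrite -{1}(subnK I_gt0) addn1 pE QK' -addn1 (subnK I_gt0) QK.
  by rewrite mulr1 mulrN addrC.
have -> : (#|I|.+1 - r = (#|I| - r).+1)%N by rewrite subSn.
have e1 := coef_prod_XsubC_elem_sym alpha rI.
have /(coef_prod_XsubC_elem_sym alpha) e2 := leq_trans (leq_subr 1 r) rI.
rewrite pE e1 (_ : (#|I| - r).+1 = (#|I| - (r - 1)))%N; last first.
  by move: rI; set c := #|_|; lia.
(* The two coefficients of [Q] involved are adjacent, so their signs are opposite. *)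
have -> : (-1) ^+ r = - (-1) ^+ (r - 1) :> F.
  by rewrite -{1}(subnK r_gt0) addn1 exprS mulN1r.
rewrite e2 bE; ring.
Qed.

End MonicProduct.

(** Such a [p] is a nonzero scalar multiple of the product over [I]. This treats (i), (ii) and (iii)
    at once: [(m, s)] is [(k, r)], [(k - 1, r - 1)] or [(k - 2, r - 2)], and [m - s] is always the
    missing degree [k - r]. *)
Lemma elem_sym_eq0P (F : finFieldType) (n m s : nat) (alpha : 'I_n -> F) :
  injective alpha -> (s <= m)%N ->
  (exists2 I : {set 'I_n}, #|I| = m & elem_sym alpha s I = 0) <->
  (exists p : {poly F}, [/\ p != 0, (size p <= m.+1)%N, p`_(m - s) = 0
    & (m <= #|roots_in alpha p|)%N]).
Proof.
move=> alpha_inj sm; split=> [[I cardI e0]|[p [p0 sz_p pms m_roots]]].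
  exists (\prod_(i in I) ('X - (alpha i)%:P)); split.
  - by rewrite monic_neq0 ?monic_prod_XsubC.
  - by rewrite size_prod_XsubC_in cardI.
  - by rewrite -cardI coef_prod_XsubC_elem_sym ?cardI // e0 mulr0.
  - by rewrite -cardI subset_leq_card // -prod_XsubC_dvdp.
have [I sI cardI] := exists_subset_card m_roots; exists I => //.
have [|g [pE g0]] := dvd_prod_XsubC_in (d := 1) alpha_inj p0 _ sI.
  by rewrite cardI addn1.
move=> /size1_polyC gE; move: pms g0.
rewrite pE gE coefCM -{1}cardI coef_prod_XsubC_elem_sym ?cardI // polyC_eq0.
by move=> /eqP; rewrite !mulf_eq0 signr_eq0 /= => /orP[->//|/eqP].
Qed.

(** * Matching the four conditions with the zero patterns of the two appended coordinates *)

Theorem theorem5p5 (F : finFieldType) (n k r : nat) (alpha : 'I_n -> F)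
    (delta : F) (alpha_inj : injective alpha)
    (r_ge2 : (2 <= r)%N) (r_le : (r <= k - 1)%N) (k_lt_n : (k < n)%N) :
  is_MDS (C2 k r alpha delta) <->
  [/\ forall I : {set 'I_n}, #|I| = k -> elem_sym alpha r I != 0,
      forall I : {set 'I_n}, #|I| = (k - 1)%N -> elem_sym alpha (r - 1) I != 0,
      forall I : {set 'I_n}, #|I| = (k - 2)%N -> elem_sym alpha (r - 2) I != 0
    & forall I : {set 'I_n}, #|I| = (k - 1)%N ->
        delta * elem_sym alpha (r - 1) I
        - (\sum_(s in I) alpha s) * elem_sym alpha (r - 1) I
        + elem_sym alpha r I != 0].
Proof.
rewrite MDS_C2P //.
have r_le_k : (r <= k)%N by rewrite (leq_trans r_le) ?leq_subr.
have r1_le : (r - 1 <= k - 1)%N by lia.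
have r2_le : (r - 2 <= k - 2)%N by lia.
have h1 : (k - 1 - (r - 1) = k - r)%N by lia.
have h2 : (k - 2 - (r - 2) = k - r)%N by lia.
split=> [few|[E0 E1 E2 D] p sz_p ph0 p0].
  split=> I cardI; apply/negP => /eqP e0.
  - have [p [p0 sz_p ph0 roots]] :
      exists p : {poly F}, [/\ p != 0, (size p <= k.+1)%N, p`_(k - r) = 0
        & (k <= #|roots_in alpha p|)%N].
      by apply/elem_sym_eq0P => //; exists I.
    by have := few p sz_p ph0 p0; rewrite ltnNge (leq_trans roots) ?leq_addr.
  - have [p [p0 sz_p ph0 roots]] :
      exists p : {poly F}, [/\ p != 0, (size p <= (k - 1).+1)%N,
        p`_(k - 1 - (r - 1)) = 0 & (k - 1 <= #|roots_in alpha p|)%N].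
      by apply/elem_sym_eq0P => //; exists I.
    (* The coefficient of degree [k] vanishes, which adds a zero to the [k - 1] roots. *)
    have sz_k : (size p <= k)%N by lia.
    move: ph0; rewrite h1 => /(few p (leqW sz_k))/(_ p0).
    rewrite (nth_default _ sz_k) eqxx; lia.
  - have [p [p0 sz_p ph0 roots]] :
      exists p : {poly F}, [/\ p != 0, (size p <= (k - 2).+1)%N,
        p`_(k - 2 - (r - 2)) = 0 & (k - 2 <= #|roots_in alpha p|)%N].
      by apply/elem_sym_eq0P => //; exists I.
    (* Both appended coordinates vanish, which adds two zeros to the [k - 2] roots. *)
    have sz_k1 : (size p <= k - 1)%N by lia.
    have sz_k : (size p <= k)%N by lia.
    move: ph0; rewrite h2 => /(few p (leqW sz_k))/(_ p0).
    rewrite (nth_default _ sz_k) (nth_default _ sz_k1) mulr0 addr0 eqxx; lia.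
  - have r_card : (0 < r <= #|I|)%N by rewrite cardI; lia.
    have kE : #|I|.+1 = k by rewrite cardI; lia.
    (* With leading coefficient 1, this [b] makes the coefficient of degree [k - 1] equal to
       [- delta], so the last coordinate vanishes. *)
    pose b := 1 * (\sum_(i in I) alpha i) - delta * 1.
    have [] := coef_linear_mul_prod alpha delta 1 b r_card.
    set p := _ * _ => pk pk1 /(_ (erefl _)); rewrite e0 mulr0 kE => ph0.
    have p0 : p != 0.
      by apply: contra_eq_neq pk => ->; rewrite coef0 eq_sym oner_neq0.
    have sz_p : (size p <= k.+1)%N.
      rewrite (leq_trans (size_polyMleq _ _)) // size_prod_XsubC_in kE.
      have : (size (1%:P * 'X + b%:P)%R <= 2)%N by rewrite mul1r size_XaddC.
      by set z := size _; lia.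
    have sI : I \subset roots_in alpha p.
      by rewrite -prod_XsubC_dvdp // dvdp_mulIr.
    have := few p sz_p ph0 p0; have := subset_leq_card sI.
    rewrite -kE subn1 /= pk pk1 /b !mul1r !mulr1.
    rewrite addrAC subrK subrr eqxx cardI oner_eq0.
    lia.
rewrite ltnNge; apply/negP.
(* Given [k] zeros, each vanishing appended coordinate lowers by one the number of roots that [p]
   must have. *)
have [pk0|pk_neq0] := eqVneq p`_k 0.
  have sz_k : (size p <= k)%N by exact: size_le_pred_coef0 pk0.
  rewrite pk0 mulr0 addr0.
  have [pk1|_] := eqVneq p`_(k - 1) 0 => roots.
    have sz_k1 : (size p <= k - 1)%N.
      by apply: size_le_pred_coef0 pk1; lia.
    have [I cardI e0] :
      exists2 I : {set 'I_n}, #|I| = (k - 2)%N & elem_sym alpha (r - 2) I = 0.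
      apply/elem_sym_eq0P => //; exists p; split=> //; rewrite ?h2 //; first lia.
      by move: roots; rewrite leq_subLR; lia.
    by have := E2 I cardI; rewrite e0 eqxx.
  have [I cardI e0] :
    exists2 I : {set 'I_n}, #|I| = (k - 1)%N & elem_sym alpha (r - 1) I = 0.
    apply/elem_sym_eq0P => //; exists p; split=> //; rewrite ?h1 //; first lia.
    by move: roots; rewrite leq_subLR; lia.
  by have := E1 I cardI; rewrite e0 eqxx.
have [pD|_] := eqVneq (p`_(k - 1) + delta * p`_k) 0 => roots.
  have [|I sI cardI] := @exists_subset_card _ (roots_in alpha p) (k - 1).
    by move: roots; rewrite leq_subLR; lia.
  have kE : #|I|.+1 = k by rewrite cardI; lia.
  have r_card : (0 < r <= #|I|)%N by rewrite cardI; lia.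
  have [|g [pE g0 sz_g]] := dvd_prod_XsubC_in (d := 2) alpha_inj p0 _ sI.
    by rewrite -kE addn2 in sz_p *.
  (* With [k - 1] roots and degree at most [k], only a linear cofactor is left. *)
  have gE : g = (g`_1)%:P * 'X + (g`_0)%:P.
    apply/polyP => i; rewrite coefD coefMX !coefC.
    case: i => [|[|i]] /=; rewrite ?add0r ?addr0 //.
    by rewrite nth_default // (leq_trans sz_g).
  have [] := coef_linear_mul_prod alpha delta g`_1 g`_0 r_card.
  rewrite -gE -pE kE => pk pk1; rewrite ph0 => Dp.
  have a0 : g`_1 != 0 by rewrite -pk.
  (* The vanishing of the last coordinate is exactly this relation; the missing term then
     contradicts (iv), as [g] has nonzero leading coefficient. *)
  have /Dp/eqP : g`_0 = g`_1 * (\sum_(i in I) alpha i) - delta * g`_1.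
    move: pD; rewrite -cardI pk pk1 => /eqP.
    by rewrite addr_eq0 subr_eq addrC => /eqP.
  rewrite eq_sym !mulf_eq0 signr_eq0 (negPf a0) /=.
  by have := D I cardI => /negPf ->.
have [I cardI e0] : exists2 I : {set 'I_n}, #|I| = k & elem_sym alpha r I = 0.
  by apply/elem_sym_eq0P => //; exists p; split=> //; move: roots; rewrite !addn0.
by have := E0 I cardI; rewrite e0 eqxx.
Qed.
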